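(* Let $n\ge 2$, let $A^{(n)}$ be a set with $n$ elements and let $G=G_{A^{(n)}}$ be its set-graph. Let $v_{n,1}$ be the vertex of $G$ corresponding to the subset $A^{(n)}$ itself. Then the primitive degree of $v_{n,1}$ is $$d^p_{G}(v_{n,1}) = |E(G)|-\Delta(G).$$
   Context: For a set $A^{(n)}$ of $n$ distinct elements, the set-graph $G_{A^{(n)}}$ is the simple undirected graph whose vertices are in bijection with the non-empty subsets of $A^{(n)}$, two distinct vertices being adjacent if and only if the corresponding subsets have non-empty intersection. A primitive hole of a graph $G$ is a cycle of length $3$ (triangle) in $G$. The primitive degree $d^p_G(v)$ of a vertex $v$ is the number of primitive holes of $G$ that contain $v$. $\Delta(G)$ denotes the maximum vertex degree of $G$. *)

(* Defs.v *)
From HB Require Import structures.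
From mathcomp Require Import all_boot all_order all_algebra.

Set Implicit Arguments.
Unset Strict Implicit.
Unset Printing Implicit Defensive.

Record sgraph := SGraph {
  svertex :> finType;
  sedge : rel svertex;
  sedge_sym : symmetric sedge;
  sedge_irrefl : irreflexive sedge }.

Definition edges (G : sgraph) : {set {set G}} :=
  [set e | [exists x, exists y, sedge x y && (e == [set x; y])]].

Definition degree (G : sgraph) (v : G) : nat := #|[set u | sedge v u]|.

Definition max_degree (G : sgraph) : nat := \max_(v : G) degree v.

(* A cycle of length 3 is determined by its vertex set, so triangles are
   counted as vertex sets. The three vertices are automatically distinct,
   because adjacency is irreflexive. *)
Definition primitive_holes (G : sgraph) : {set {set G}} :=
  [set C | [exists x, exists y, exists z,
     [&& sedge x y, sedge y z, sedge z x & C == [set x; y; z]]]].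

Definition primitive_degree (G : sgraph) (v : G) : nat :=
  #|[set C in primitive_holes G | v \in C]|.

Definition nonempty_subset (T : finType) : finType := {B : {set T} | B != set0}.

Definition meets (T : finType) : rel (nonempty_subset T) :=
  fun B C => (B != C) && (val B :&: val C != set0).

Lemma meets_sym (T : finType) : symmetric (@meets T).
Proof. by move=> B C; rewrite /meets eq_sym setIC. Qed.

Lemma meets_irrefl (T : finType) : irreflexive (@meets T).
Proof. by move=> B; rewrite /meets eqxx. Qed.

Definition set_graph (T : finType) : sgraph :=
  SGraph (@meets_sym T) (@meets_irrefl T).

Lemma setT_neq0 (T : finType) (n : nat) (hn : 2 <= n) (hT : #|T| = n) :
  [set: T] != set0.
Proof. by rewrite -card_gt0 cardsT hT ltnW. Qed.

Definition full_vertex (T : finType) (n : nat) (hn : 2 <= n) (hT : #|T| = n) :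
  set_graph T := exist _ [set: T] (setT_neq0 hn hT).

(* Main.v *)
(** The vertex [v] of the full set is adjacent to every other vertex. In any graph
    with such a dominating vertex, adding [v] to an edge that avoids [v] gives a
    bijection onto the triangles through [v], while the edges that contain [v] are
    counted by its degree, which is maximal. *)

Require Import Defs.
From HB Require Import structures.
From mathcomp Require Import all_boot all_order all_algebra.

Section DominatingVertex.
Variable G : sgraph.
Implicit Types (u v x y z : G) (e C : {set G}).

Lemma edgesP e :
  reflect (exists x y, sedge x y /\ e = [set x; y]) (e \in edges G).
Proof.
rewrite inE; apply: (iffP existsP) => [[x /existsP[y /andP[xy /eqP->]]]|].
  by exists x, y.
by case=> x [y [xy ->]]; exists x; apply/existsP; exists y; rewrite xy eqxx.
Qed.

Lemma primitive_holesP C :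
  reflect (exists x y z, [/\ sedge x y, sedge y z, sedge z x & C = [set x; y; z]])
          (C \in primitive_holes G).
Proof.
rewrite inE; apply: (iffP existsP).
  case=> x /existsP[y /existsP[z /and4P[xy yz zx /eqP->]]].
  by exists x, y, z.
case=> x [y [z [xy yz zx ->]]]; exists x; apply/existsP; exists y.
by apply/existsP; exists z; rewrite xy yz zx eqxx.
Qed.

Lemma sedge_neq {u v} : sedge u v -> u != v.
Proof. by apply: contraTneq => ->; rewrite sedge_irrefl. Qed.

(** A triangle can be rotated cyclically until [v] comes first; the three cases of the proof are the
    possible positions of [v]. *)
Lemma primitive_holesP_mem v C :
  reflect (exists x y, [/\ sedge v x, sedge x y, sedge y v & C = v |: [set x; y]])
          ((C \in primitive_holes G) && (v \in C)).
Proof.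
apply: (iffP andP) => [[/primitive_holesP[x [y [z [xy yz zx ->]]]]]|]; last first.
  case=> x [y [vx xy yv ->]]; rewrite setU11; split=> //.
  by apply/primitive_holesP; exists v, x, y; rewrite setUA.
rewrite !inE -orbA => /or3P[] /eqP->.
- by exists y, z; rewrite setUA.
- by exists z, x; rewrite -setUA setUC -setUA.
- by exists x, y; split=> //; rewrite setUC.
Qed.

Lemma card_incident_edges v : #|[set e in edges G | v \in e]| = degree v.
Proof.
(* A neighbour [u] corresponds to the edge [[set v; u]]. This is injective: a neighbour [x] lying in
   [[set v; y]] differs from [v], so it is [y]. *)
rewrite /degree -(@card_in_imset _ _ (fun u => [set v; u])); last first.
  move=> x y; rewrite !inE => vx _ /setP/(_ x).
  by rewrite !inE eqxx orbT [x == v]eq_sym (negPf (sedge_neq vx)) => /esym/eqP.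
apply: eq_card => e; rewrite inE; apply/andP/imsetP => [[]|[u]].
  case/edgesP=> x [y [xy ->]]; rewrite !inE => /orP[] /eqP->.
    by exists y; rewrite ?inE.
  by exists x; rewrite ?inE 1?sedge_sym // setUC.
rewrite inE => vu ->; split; last exact: set21.
by apply/edgesP; exists v, u.
Qed.

Lemma degree_le v : degree v <= #|G|.-1.
Proof.
rewrite -(cardsC1 v); apply/subset_leq_card/subsetP=> u.
by rewrite !inE eq_sym => /sedge_neq.
Qed.

Variable v : G.
Hypothesis dom_v : forall u, u != v -> sedge v u.

(** Having no loops bounds every degree by [#|G|.-1], and [v] attains this bound. *)
Lemma max_degree_dominating : max_degree G = degree v.
Proof.
have deg_v : degree v = #|G|.-1.
  rewrite -(cardsC1 v); apply: eq_card => u; rewrite !inE.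
  by apply/idP/idP => [/sedge_neq|/dom_v //]; rewrite eq_sym.
apply/eqP; rewrite eqn_leq leq_bigmax andbT.
by apply/bigmax_leqP => u _; rewrite deg_v degree_le.
Qed.

Lemma primitive_degree_dominating :
  primitive_degree v = #|[set e in edges G | v \notin e]|.
Proof.
(* Deleting [v] again recovers [e], since [e] avoids [v]. *)
rewrite -(@card_in_imset _ _ (fun e => v |: e)); last first.
  move=> e f; rewrite !inE => /andP[_ ve] /andP[_ vf] eq_ef.
  by rewrite -(setU1K ve) eq_ef setU1K.
apply: eq_card => C; rewrite inE.
apply/primitive_holesP_mem/imsetP => [[x [y [vx xy yv ->]]]|[e]].
  exists [set x; y] => //; rewrite inE; apply/andP; split.
    by apply/edgesP; exists x, y.
  by rewrite !inE negb_or (sedge_neq vx) eq_sym (sedge_neq yv).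
rewrite inE => /andP[/edgesP[x [y [xy ->]]]].
rewrite !inE negb_or => /andP[vx vy] ->; exists x, y.
(* Domination supplies the two sides of the triangle that meet at [v]. *)
by split=> //; [|rewrite sedge_sym]; apply: dom_v; rewrite eq_sym.
Qed.

Lemma card_edges_dominating :
  #|edges G| = primitive_degree v + max_degree G.
Proof.
rewrite max_degree_dominating primitive_degree_dominating -card_incident_edges.
(* Split the edges according to whether they contain [v]. *)
rewrite addnC -(cardsID [set e : {set G} | v \in e] (edges G)).
by congr addn; apply: eq_card => e; rewrite !inE // andbC.
Qed.

End DominatingVertex.

Lemma full_vertex_dominating (T : finType) (n : nat) (hn : 2 <= n) (hT : #|T| = n)
    (B : set_graph T) :
  B != full_vertex hn hT -> sedge (full_vertex hn hT) B.
Proof.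
move=> neqB; apply/andP; split; first by rewrite eq_sym.
(* Intersecting with the full set leaves [B] itself, nonempty by its subtype property. *)
by rewrite setTI (valP B).
Qed.

Theorem proposition2p9 (n : nat) (hn : 2 <= n) (T : finType) (hT : #|T| = n) :
  ((primitive_degree (full_vertex hn hT))%:Z =
     #|edges (set_graph T)|%:Z - (max_degree (set_graph T))%:Z)%R.
Proof.
rewrite (card_edges_dominating _ _ (@full_vertex_dominating T n hn hT)).
by rewrite PoszD GRing.addrK.
Qed.
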